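(* There is an absolute constant $d$ such that for every $N\ge1$ and every $X\in\{0,1\}^N$, $$C_{GP}(X)\le C_{OP}(Y)+d\log^2 N,$$ where $Y=X_0X_1\cdots X_{M-1}$ is the prefix of $X$ of length $M$, with $M$ defined as follows: if $X$ has equally many zeros and ones then $M=N$; otherwise $M$ is the (1-indexed) position in $X$ of the $(\lfloor N/2\rfloor+1)$-st bit whose value equals the majority value of $X$.
   Context: Logarithms are base $2$. Both algorithms below maintain a list $\mathcal S=(S_1,\dots,S_\ell)$ of disjoint subsets of $\{0,\dots,N-1\}$ (''blocks'') on which $X$ is known to be constant; $X_{S_j}$ denotes that common value, and initially $\mathcal S=(\{0\},\{1\},\dots,\{N-1\})$. Oblivious-pairing algorithm: COMBINE$(\mathcal S,i)$ queries $X_a\oplus X_b$ for some $a\in S_i$, $b\in S_{i+1}$; if $0$, it replaces $S_i,S_{i+1}$ by $S_i\cup S_{i+1}$ at that position, otherwise it removes both. For $k=1,\dots,\lfloor\log N\rfloor$ in turn: while some $j<\ell$ has $|S_j|=|S_{j+1}|=2^{k-1}$, apply COMBINE$(\mathcal S,j)$ for the smallest such $j$. Finally output ''tie'' if $\mathcal S$ is empty, else $X_{S_1}$. Greedy-pairing algorithm: COMBINE$(\mathcal S,i)$ queries $X_a\oplus X_b$ for some $a\in S_i,b\in S_{i+1}$; if $0$, it replaces $S_i,S_{i+1}$ by $S_i\cup S_{i+1}$ at that position; otherwise, if $|S_i|>|S_{i+1}|$ it removes $|S_{i+1}|$ elements from $S_i$ and removes $S_{i+1}$ from the list, and if $|S_i|=|S_{i+1}|$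 it removes both. Let $s_1$ be the largest integer $t$ with $2^t$ dividing $|S_1|$ and $s_j=\log|S_j|$ for $j\ge2$ (these blocks have power-of-two sizes). While $\ell>0$ and $|S_1|\le\sum_{j=2}^{\ell}|S_j|$: let $i$ be the smallest $j$ with $s_j=s_{j+1}$; if $\sum_{j=1}^{i}|S_j|>\sum_{j=i+1}^{\ell}|S_j|$ reset $i:=1$; apply COMBINE$(\mathcal S,i)$. Finally output ''tie'' if $\mathcal S$ is empty, else $X_{S_1}$. $C_{OP}(X)$ and $C_{GP}(X)$ denote the number of XOR queries (COMBINE operations) made on input $X$ by the oblivious-pairing and greedy-pairing algorithms respectively (for inputs of the corresponding length). *)

(* Defs.v *)
From mathcomp Require Import all_boot.

Set Implicit Arguments.
Unset Strict Implicit.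
Unset Printing Implicit Defensive.

(* Blocks are sequences of indices into X; a list of blocks is S = (S_1,...,S_l),
   stored 0-based: S_1 = nth [::] S 0. *)

Definition bitX (X : seq bool) (a : nat) : bool := nth false X a.

(* The XOR query X_a (+) X_b, with a the first element of A and b the first
   element of B (blocks are constant-valued, so the choice is immaterial). *)
Definition query (X : seq bool) (A B : seq nat) : bool :=
  xorb (bitX X (head 0 A)) (bitX X (head 0 B)).

(* Smallest 0-based index j with P (S_j) (S_{j+1}); returns size S if none. *)
Fixpoint first_pair (T : Type) (P : T -> T -> bool) (S : seq T) : nat :=
  match S with
  | A :: ((B :: _) as S') => if P A B then 0 else (first_pair P S').+1
  | _ => size S
  end.

Definition combine_op (X : seq bool) (S : seq (seq nat)) (i : nat)
  : seq (seq nat) :=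
  let A := nth [::] S i in
  let B := nth [::] S i.+1 in
  if ~~ query X A B then take i S ++ (A ++ B) :: drop i.+2 S
  else take i S ++ drop i.+2 S.

(* Phase with block size p = 2^(k-1): while some adjacent pair both have size p,
   combine the leftmost such pair.  Returns (new list, number of queries added).
   Each COMBINE shortens the list, so fuel = initial length suffices. *)
Fixpoint op_phase (fuel : nat) (X : seq bool) (p : nat)
    (S : seq (seq nat)) (cnt : nat) : seq (seq nat) * nat :=
  match fuel with
  | 0 => (S, cnt)
  | f.+1 =>
      let j := first_pair (fun A B : seq nat => (size A == p) && (size B == p)) S in
      if j.+1 < size S then op_phase f X p (combine_op X S j) cnt.+1
      else (S, cnt)
  end.

Definition init_blocks (N : nat) : seq (seq nat) := [seq [:: a] | a <- iota 0 N].

Definition op_run (X : seq bool) : seq (seq nat) * nat :=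
  let N := size X in
  foldl (fun (st : seq (seq nat) * nat) (k : nat) =>
           op_phase N X (2 ^ k.-1) st.1 st.2)
        (init_blocks N, 0) (iota 1 (trunc_log 2 N)).

Definition C_OP (X : seq bool) : nat := (op_run X).2.

Definition combine_gp (X : seq bool) (S : seq (seq nat)) (i : nat)
  : seq (seq nat) :=
  let A := nth [::] S i in
  let B := nth [::] S i.+1 in
  if ~~ query X A B then take i S ++ (A ++ B) :: drop i.+2 S
  else if size B < size A then take i S ++ drop (size B) A :: drop i.+2 S
  else if size A == size B then take i S ++ drop i.+2 S
  (* |S_i| < |S_{i+1}|: not specified in the paper; symmetric convention *)
  else take i S ++ drop (size A) B :: drop i.+2 S.

Definition svals (S : seq (seq nat)) : seq nat :=
  match S with
  | [::] => [::]
  | A :: S' => logn 2 (size A) :: [seq trunc_log 2 (size B) | B <- S']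
  end.

Definition sumsizes (S : seq (seq nat)) : nat := sumn [seq size A | A <- S].

Definition gp_index (S : seq (seq nat)) : nat :=
  let i := first_pair (fun a b : nat => a == b) (svals S) in
  if sumsizes (take i.+1 S) > sumsizes (drop i.+1 S) then 0 else i.

Fixpoint gp_loop (fuel : nat) (X : seq bool) (S : seq (seq nat)) (cnt : nat)
  : nat :=
  match fuel with
  | 0 => cnt
  | f.+1 =>
      if (0 < size S) && (size (head [::] S) <= sumsizes (behead S))
      then gp_loop f X (combine_gp X S (gp_index S)) cnt.+1
      else cnt
  end.

(* C_GP(X): number of XOR queries made by greedy pairing on X
   (each iteration shortens the list, so fuel N+1 suffices). *)
Definition C_GP (X : seq bool) : nat :=
  gp_loop (size X).+1 X (init_blocks (size X)) 0.

Definition prefM (X : seq bool) : nat :=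
  let N := size X in
  let ones := count id X in
  let zeros := count negb X in
  if ones == zeros then N
  else
    let v := zeros < ones in
    (* smallest m such that the first m bits contain floor(N/2)+1 copies of v,
       i.e. the 1-indexed position of the (floor(N/2)+1)-st occurrence of v *)
    find (fun m => count (pred1 v) (take m X) == N./2.+1) (iota 0 N.+1).

(* Main.v *)
Require Import Defs.
From mathcomp Require Import all_boot.
From mathcomp Require Import zify.

Set Implicit Arguments.
Unset Strict Implicit.
Unset Printing Implicit Defensive.

(** Greedy pairing is compared with a ghost run of oblivious pairing. The ghost
    keeps a list of blocks of sizes [2 ^ k]; an initial segment [Ab] of it, with
    strictly decreasing sizes, has been absorbed into [S_1], in the sense that
    [S_1] is the signed sum of [Ab]; the other greedy blocks coincide with the
    other ghost blocks. A COMBINE that is not a reset matches at least one ghost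
    merge. By the definition of [M], the greedy algorithm resets before
    a ghost merge could involve a bit outside [Y]. The number of ghost merges
    inside [Y] is at most [C_OP Y], because merging the first two blocks of any
    level lowers the potential [pending] by exactly one.

    A reset absorbs the next block [b]. It forces [h < 4 |b|], where [h] is the
    nonincreasing quantity |S_2| + ... + |S_l| - |S_1|. If [b] has the value of
    [S_1], then [h] is at least halved, which happens O(log N) times. If [b] has
    the other value, it is counted in [against]; it leaves [Ab] by a ghost
    merge that [S_1] did not pay for, or by meeting a block with the value of
    [S_1], which halves [h] again. Hence
    C_GP(X) <= C_OP(Y) + O(log N). *)

(** * Weighted block lists and the pairing potential *)

(* An element [(k, x)] stands for a block of [2 ^ k] bits of common value [x]. *)
Definition weight (v : bool) (B : seq (nat * bool)) : nat :=
  \sum_(b <- B | b.2 == v) 2 ^ b.1.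

Definition mass (B : seq (nat * bool)) : nat := \sum_(b <- B) 2 ^ b.1.

Definition against (v : bool) (B : seq (nat * bool)) : nat :=
  count (fun b => b.2 != v) B.

Definition dec : rel (nat * bool) := [rel a b | b.1 < a.1].
Definition ndec : rel (nat * bool) := [rel a b | b.1 <= a.1].

Definition merge_bits (k : nat) (x y : bool) : seq (nat * bool) :=
  if x == y then [:: (k.+1, x)] else [::].

Lemma weight_cat v B C : weight v (B ++ C) = weight v B + weight v C.
Proof. by rewrite /weight big_cat. Qed.

Lemma weight_cons v b B :
  weight v (b :: B) = (if b.2 == v then 2 ^ b.1 else 0) + weight v B.
Proof. by rewrite /weight big_cons; case: ifP. Qed.

Lemma weight_nil v : weight v [::] = 0. Proof. by rewrite /weight big_nil. Qed.

Lemma mass_cat B C : mass (B ++ C) = mass B + mass C.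
Proof. by rewrite /mass big_cat. Qed.

Lemma mass_cons b B : mass (b :: B) = 2 ^ b.1 + mass B.
Proof. by rewrite /mass big_cons. Qed.

Lemma mass_nil : mass [::] = 0. Proof. by rewrite /mass big_nil. Qed.

Lemma level_lt_mass P b R : b.1 < mass (P ++ b :: R).
Proof.
by rewrite mass_cat mass_cons addnCA; apply: leq_trans (ltn_expl _ _) (leq_addr _ _).
Qed.

Lemma mass_weight v B : mass B = weight v B + weight (~~ v) B.
Proof.
rewrite /mass /weight (bigID (fun b => b.2 == v)) /=; congr (_ + _).
by apply: eq_bigl => b; case: b.2; case: v.
Qed.

(** A merge keeps the signed sum: equal values add up, opposite ones cancel. The difference of the
    two weights is written additively to avoid truncated subtraction. *)
Lemma weight_merge v k x y :
  weight v (merge_bits k x y) + weight (~~ v) [:: (k, x); (k, y)] =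
  weight (~~ v) (merge_bits k x y) + weight v [:: (k, x); (k, y)].
Proof.
by rewrite /merge_bits; case: v x y => [] [] [];
   rewrite /= !(weight_cons, weight_nil) /= ?expnS; lia.
Qed.

Lemma mass_merge k x y : mass (merge_bits k x y) <= mass [:: (k, x); (k, y)].
Proof.
by rewrite /merge_bits; case: eqP => _;
   rewrite !(mass_cons, mass_nil) /= ?expnS; lia.
Qed.

Lemma dec_trans : transitive dec.
Proof. by move=> b a c /= h1 h2; apply: ltn_trans h2 h1. Qed.

Lemma ndec_trans : transitive ndec.
Proof. by move=> b a c /= h1 h2; apply: leq_trans h2 h1. Qed.

Lemma pairwise_ndec_neq B :
  pairwise ndec B -> sorted (fun a b => a.1 != b.1) B -> pairwise dec B.
Proof.
rewrite -(sorted_pairwise dec_trans) -(sorted_pairwise ndec_trans).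
case: B => //= b B; elim: B b => //= c B IH b /andP[h1 h2] /andP[h3 h4].
by rewrite IH // andbT /dec /= ltn_neqAle eq_sym h3.
Qed.

Lemma mass_dec b B : pairwise dec (b :: B) -> mass (b :: B) < 2 * 2 ^ b.1.
Proof.
elim: B b => [|c B IH] b; first by rewrite mass_cons mass_nil; have := expn_gt0 2 b.1; lia.
rewrite pairwise_cons => /andP[/= /andP[bc _] H].
have {IH} := IH c H; rewrite mass_cons => h.
have : 2 ^ c.1.+1 <= 2 ^ b.1 by rewrite leq_exp2l.
by rewrite !mass_cons expnS; lia.
Qed.

(** Distinct levels force at least the mass of [1, 2, 4, ...]; hence the absorbed segment has only
    logarithmically many blocks. *)
Lemma size_dec B : pairwise dec B -> 2 ^ size B <= (mass B).+1.
Proof.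
have H : forall n B, pairwise dec B -> all (fun b => n <= b.1) B ->
   2 ^ n * 2 ^ size B <= mass B + 2 ^ n.
  move=> n {}B; elim/last_ind: B n => [|B b IH] n; first by rewrite mass_nil muln1.
  rewrite pairwise_rcons -cats1 all_cat all_seq1 => /andP[hB1 hB2] /andP[h1 h2].
  have /= := IH n.+1 hB2.
  have hh : all (fun a => n < a.1) B by apply: sub_all hB1 => a /= /(leq_ltn_trans _); exact.
  move=> /(_ hh); rewrite size_cat mass_cat addn1 mass_cons mass_nil !expnS.
  have : 2 ^ n <= 2 ^ b.1 by rewrite leq_exp2l.
  lia.
by move=> h; have := H 0 B h; rewrite mul1n addn1; apply; apply/allP.
Qed.

Definition level (k : nat) (B : seq (nat * bool)) : seq bool :=
  [seq b.2 | b <- B & b.1 == k].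

Fixpoint pair_up (s : seq bool) : seq bool :=
  if s is x :: y :: s' then
    if x == y then x :: pair_up s' else pair_up s'
  else [::].

(* The level-[k] blocks that oblivious pairing ever has to process from [B]:
   those present in [B], then those produced at level [k - 1]. *)
Fixpoint arrivals (B : seq (nat * bool)) (k : nat) : seq bool :=
  if k is k'.+1 then level k B ++ pair_up (arrivals B k') else level 0 B.

(** Each query at level [k] uses up two arrivals, so for large enough [K] this is the number of
    queries that oblivious pairing makes from [B]. *)
Definition pending (K : nat) (B : seq (nat * bool)) : nat :=
  \sum_(k < K) (size (arrivals B k))./2.

Lemma level_cat k B C : level k (B ++ C) = level k B ++ level k C.
Proof. by rewrite /level filter_cat map_cat. Qed.

Lemma level_nil k B : all (fun b => b.1 != k) B -> level k B = [::].
Proof.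
move=> h; rewrite /level (@eq_in_filter _ _ pred0) ?filter_pred0 // => b hb.
by move/allP: h => /(_ b hb) /negbTE.
Qed.

(** [P] has only larger levels, so the pair comes first at level [k]; [Q] has none above [k], so the
    new block comes last among the blocks present at level [k.+1]. That is where [pair_up] would
    have put it, so only the summand at [k] changes. *)
Lemma pending_merge K P k x y Q :
  all (fun b => k < b.1) P -> all (fun b => b.1 <= k) Q -> k < K ->
  pending K (P ++ (k, x) :: (k, y) :: Q) =
  (pending K (P ++ merge_bits k x y ++ Q)).+1.
Proof.
move=> hP hQ hk; set B := P ++ _; set B' := P ++ _.
have lP i : i <= k -> level i P = [::].
  by move=> hi; apply: level_nil; apply: sub_all hP => b /=; lia.
have lQ i : k < i -> level i Q = [::].
  by move=> hi; apply: level_nil; apply: sub_all hQ => b /=; lia.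
have lB i : level i B = level i P ++ (if i == k then [:: x; y] else [::]) ++ level i Q.
  by rewrite level_cat -[_ :: _ :: Q]/([:: (k, x); (k, y)] ++ Q) level_cat /level /= eq_sym;
     case: eqP.
have lB' i : level i B' = level i P ++
    (if (i == k.+1) && (x == y) then [:: x] else [::]) ++ level i Q.
  by rewrite !level_cat /level /merge_bits; case: (x == y); rewrite ?andbF //= eq_sym;
     case: eqP.
have lt_eq i : i < k -> arrivals B i = arrivals B' i.
  elim: i => [|i IH] hi /=; rewrite lB lB'.
    by rewrite (ltn_eqF hi).
  rewrite IH ?(ltn_eqF hi) ?(@ltn_eqF _ k.+1) //; lia.
have kE : arrivals B k = x :: y :: arrivals B' k.
  case: (k) lB lB' lt_eq lP => [|k'] lB lB' lt_eq lP /=; rewrite lB lB' lP //= !eqxx.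
  by rewrite (@ltn_eqF _ k'.+2) //= lt_eq.
have gt_eq i : k < i -> arrivals B i = arrivals B' i.
  elim: i => [//|i IH]; rewrite ltnS leq_eqVlt => /orP[/eqP <-|hi] /=.
    rewrite kE /= lB lB' lQ // eqxx gtn_eqF //= !cats0.
    by case: (x == y); rewrite /= ?cats0 // -catA.
  by rewrite IH // lB lB' eqSS !gtn_eqF ?ltnS // ltnW.
rewrite /pending (bigD1 (Ordinal hk)) //= [in RHS](bigD1 (Ordinal hk)) //= kE /=.
rewrite -addSn; congr (_ + _); apply: eq_bigr => i; rewrite -val_eqE /= => hi.
by case: (ltnP i k) => h; [rewrite lt_eq | rewrite gt_eq // ltn_neqAle eq_sym hi].
Qed.

Lemma pending0 K B : (forall k, size (level k B) <= 1) -> pending K B = 0.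
Proof.
move=> h; have e k : arrivals B k = level k B.
  elim: k => //= k ->; have := h k.
  by case: (level k B) => [|? [|? ?]] //=; rewrite cats0.
by apply: big1 => i _; rewrite e; have := h i; case: size => [|[]].
Qed.

(** * Concrete blocks *)

Definition constant_on (X : seq bool) (A : seq nat) : bool :=
  all (fun a => bitX X a == bitX X (head 0 A)) A.

Definition good_block (X : seq bool) (A : seq nat) : bool :=
  (size A == 2 ^ trunc_log 2 (size A)) && constant_on X A.

Definition block_type (X : seq bool) (A : seq nat) : nat * bool :=
  (trunc_log 2 (size A), bitX X (head 0 A)).

Lemma constant_on_cat X A B :
  0 < size A -> constant_on X A -> constant_on X B ->
  bitX X (head 0 A) = bitX X (head 0 B) -> constant_on X (A ++ B).
Proof.
case: A => //= a A _ hA hB e; rewrite /constant_on -cat_cons all_cat; apply/andP; split=> //.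
by apply: sub_all hB => b /eqP ->; rewrite /= e.
Qed.

Lemma constant_on_drop X A n :
  n < size A -> constant_on X A ->
  constant_on X (drop n A) /\ bitX X (head 0 (drop n A)) = bitX X (head 0 A).
Proof.
move=> hn /allP h.
have e : bitX X (head 0 (drop n A)) = bitX X (head 0 A).
  by apply/eqP; apply: h; rewrite -nth0 nth_drop addn0 mem_nth.
by split=> //; apply/allP => b /mem_drop /h; rewrite e.
Qed.

Lemma good_block_gt0 X A : good_block X A -> 0 < size A.
Proof. by case/andP=> /eqP -> _; rewrite expn_gt0. Qed.

Lemma good_block_size X A k x :
  good_block X A -> block_type X A = (k, x) -> size A = 2 ^ k.
Proof. by case/andP=> /eqP h _ [<- _]. Qed.

Lemma mass_blocks X S :
  all (good_block X) S -> mass (map (block_type X) S) = sumsizes S.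
Proof.
elim: S => [|A S IH]; first by rewrite mass_nil.
by rewrite [map _ _]/= mass_cons => /andP[/andP[/eqP h _] /IH ->]; rewrite -h.
Qed.

Lemma first_pair_split (T : Type) (P : T -> T -> bool) (S : seq T) :
  (first_pair P S = size S /\ sorted (fun a b => ~~ P a b) S) \/
  exists S1 a b S2, [/\ S = S1 ++ a :: b :: S2, first_pair P S = size S1, P a b
    & sorted (fun a b => ~~ P a b) (rcons S1 a)].
Proof.
elim: S => [|a [|b S] IH]; [by left | by left |].
case hab: (P a b).
  by right; exists [::], a, b, S; rewrite /= hab.
have -> : first_pair P [:: a, b & S] = (first_pair P (b :: S)).+1 by rewrite /= hab.
case: IH => [[-> h]|[S1 [c [d [S2 [e -> hP hs]]]]]].
  by left; split=> //; move: h => /= ->; rewrite hab.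
right; exists (a :: S1), c, d, S2; split; rewrite ?e //.
case: S1 e hs => [|e S1] /= [<- _]; by rewrite hab.
Qed.

Lemma first_pair_map (T U : Type) (P : U -> U -> bool) (f : T -> U) (S : seq T) :
  first_pair P (map f S) = first_pair (fun a b => P (f a) (f b)) S.
Proof.
elim: S => [|a [|b S] IH] //.
by move: IH; rewrite /= => ->.
Qed.

Definition merged (X : seq bool) (A B : seq nat) : seq (seq nat) :=
  if ~~ query X A B then [:: A ++ B] else [::].

Lemma take_drop_mid (T : Type) (x0 : T) (C : seq T) a b Q :
  [/\ nth x0 (C ++ a :: b :: Q) (size C) = a,
      nth x0 (C ++ a :: b :: Q) (size C).+1 = b,
      take (size C) (C ++ a :: b :: Q) = C
    & drop (size C).+2 (C ++ a :: b :: Q) = Q].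
Proof.
by elim: C => [|c C [? ? e ?]]; split=> //=; rewrite ?drop0 // e.
Qed.

Lemma combine_opE X C A B Q :
  combine_op X (C ++ A :: B :: Q) (size C) = C ++ merged X A B ++ Q.
Proof.
rewrite /combine_op; have [-> -> -> ->] := take_drop_mid [::] C A B Q.
by rewrite /merged; case: ifP.
Qed.

Lemma combine_gpE X C A B Q : size A = size B ->
  combine_gp X (C ++ A :: B :: Q) (size C) = C ++ merged X A B ++ Q.
Proof.
move=> e; rewrite /combine_gp; have [-> -> -> ->] := take_drop_mid [::] C A B Q.
by rewrite /merged e ltnn eqxx; case: ifP.
Qed.

Lemma query_eq X A B : ~~ query X A B = (bitX X (head 0 A) == bitX X (head 0 B)).
Proof. by rewrite /query; case: bitX; case: bitX. Qed.

Lemma merged_blocks X A B k x y :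
  good_block X A -> good_block X B ->
  block_type X A = (k, x) -> block_type X B = (k, y) ->
  all (good_block X) (merged X A B) /\
  map (block_type X) (merged X A B) = merge_bits k x y.
Proof.
move=> gA gB tA tB; have sA := good_block_size gA tA; have sB := good_block_size gB tB.
rewrite /merged query_eq; case: tA tB => _ eA [_ eB]; rewrite eA eB /merge_bits.
case: eqP => // exy; have sAB : size (A ++ B) = 2 ^ k.+1.
  by rewrite size_cat sA sB expnS mul2n addnn.
have A0 := good_block_gt0 gA.
rewrite /= /good_block /block_type sAB trunc_expnK // eqxx constant_on_cat //.
- by split=> //; congr [:: (_, _)]; rewrite -eA; case: (A) A0.
- by case/andP: gA.
- by case/andP: gB.
- by rewrite eA eB.
Qed.

Lemma pairwise_merge P k x y Q :
  pairwise ndec (P ++ (k, x) :: (k, y) :: Q) -> all (fun b => k < b.1) P ->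
  pairwise ndec (P ++ merge_bits k x y ++ Q) /\ all (fun b => b.1 <= k) Q.
Proof.
rewrite !pairwise_cat !pairwise_cons !allrel_consr /= -!andbA.
case/and5P=> _ hP1 hPQ hP /and3P[_ hQ1 /andP[_ hQ]] hk.
rewrite /merge_bits; case: eqP => _ /=; rewrite ?allrel_consr ?hPQ ?hP ?hQ ?hQ1 /=.
  split=> //; rewrite !andbT; apply/andP; split; first exact: sub_all hk.
  by rewrite /allrel /= andbT; apply: sub_all hQ1 => b /= /leqW.
by split.
Qed.

(** * Oblivious pairing *)

Lemma merge_blocks K X S1 A C S2 k x y :
  let S := S1 ++ A :: C :: S2 in
  let S' := S1 ++ merged X A C ++ S2 in
  let B := map (block_type X) S in
  let B' := map (block_type X) S' in
  all (good_block X) S -> pairwise ndec B ->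
  block_type X A = (k, x) -> block_type X C = (k, y) ->
  all (fun b => k < b.1) (map (block_type X) S1) -> mass B <= K ->
  [/\ all (good_block X) S', pairwise ndec B', mass B' <= mass B,
      pending K B = (pending K B').+1
    & forall i, i < k -> level i B' = level i B].
Proof.
move=> S S' B B'; rewrite /B /B' /S /S' !map_cat [map _ [:: _, _ & _]]/=.
rewrite !all_cat [all _ [:: _, _ & _]]/= => /and4P[g1 gA gC g2] hB tA tC h1.
have [gM ->] := merged_blocks gA gC tA tC.
rewrite tA tC in hB *; have [hB' hk] := pairwise_merge hB h1 => hm.
have eQ : [:: (k, x), (k, y) & map (block_type X) S2] =
  [:: (k, x); (k, y)] ++ map (block_type X) S2 by [].
split=> //.
- by rewrite g1 gM.
- by have := mass_merge k x y; rewrite eQ !mass_cat; lia.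
- by apply: pending_merge => //; apply: leq_trans (level_lt_mass _ (k, x) _) hm.
- move=> i hi; rewrite eQ !level_cat /level /merge_bits.
  by case: eqP; rewrite /= ?(gtn_eqF hi) // gtn_eqF // ltnW.
Qed.

Lemma size_level_le1 k B :
  pairwise ndec B -> sorted (fun a b => ~~ ((a.1 == k) && (b.1 == k))) B ->
  size (level k B) <= 1.
Proof.
elim: B => [//|b B IH]; rewrite pairwise_cons => /andP[hb hB] hs.
rewrite /level /=; case: eqP => [e|_] /=; last by apply: IH hB (path_sorted hs).
case: B hb hB hs {IH} => [//|c B] /= /andP[bc _] /andP[hc _] /andP[]; rewrite e eqxx /= => ck _.
have lt : c.1 < k by rewrite ltn_neqAle ck -e.
rewrite (negbTE ck) ltnS leqn0 size_eq0 -/(level k B) level_nil //.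
by apply: sub_all hc => d /= h; rewrite ltn_eqF // (leq_ltn_trans h).
Qed.

(** Each COMBINE adds one query and lowers [pending] by one. The phase stops when no adjacent pair
    of level [k] is left, and blocks of level [k] are contiguous. *)
Lemma op_phase_spec K f X k S cnt :
  size S <= f -> all (good_block X) S -> pairwise ndec (map (block_type X) S) ->
  mass (map (block_type X) S) <= K ->
  let r := op_phase f X (2 ^ k) S cnt in
  let B := map (block_type X) S in
  let B' := map (block_type X) r.1 in
  [/\ size r.1 <= size S, all (good_block X) r.1, pairwise ndec B', mass B' <= mass B
    & [/\ r.2 + pending K B' = cnt + pending K B, size (level k B') <= 1
        & forall i, i < k -> level i B' = level i B]].
Proof.
elim: f S cnt => [|f IH] S cnt; first by case: S.
move=> hf hg hB hm; rewrite [op_phase _ _ _ _ _]/=; set P := fun A C => _.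
have isk A : good_block X A -> (size A == 2 ^ k) = ((block_type X A).1 == k).
  case/andP=> /eqP gA _; rewrite /block_type /= gA trunc_expnK //.
  by rewrite eqn_exp2l.
have [[-> hs]|[S1 [A [C [S2 [e -> hP hs]]]]]] := first_pair_split P S.
  rewrite ltnNge leqnSn /=; split=> //; split=> //; apply: size_level_le1 => //.
  rewrite sorted_map; apply: sub_in_sorted hg hs.
  by move=> A C gA gC; rewrite /P /relpre /= !isk.
have lt : (size S1).+1 < size S by rewrite e size_cat /=; lia.
rewrite lt e combine_opE; rewrite e in hf hg hB hm.
have /and3P[g1 gA /andP[gC g2]] : [&& all (good_block X) S1, good_block X A & all (good_block X) (C :: S2)].
  by move: hg; rewrite all_cat.
move: hP; rewrite /P !isk // => /andP[/eqP kA /eqP kC].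
have tA : block_type X A = (k, bitX X (head 0 A)) by rewrite -kA.
have tC : block_type X C = (k, bitX X (head 0 C)) by rewrite -kC.
(* The pair is leftmost: the block [D] just before [A] is not of level [k], so it is strictly larger
   than [A], and so is all that precedes it. *)
have h1 : all (fun b => k < b.1) (map (block_type X) S1).
  move: hB; rewrite map_cat pairwise_cat /= allrel_consr tA => /and3P[/andP[hl _] hp _].
  case/lastP: S1 hs hl hp g1 {e hf hg hm lt} => [//|S1 D].
  rewrite !map_rcons -!cats1 -catA sorted_cat_cons !all_cat pairwise_cat.
  rewrite allrel_consr /= => /andP[_ /andP[]].
  rewrite /P; move=> hDA _ /and3P[hl hD _] /and3P[/andP[hl' _] _ _] /and3P[_ gD _].
  have kD : k < (block_type X D).1.
    move: hDA; rewrite !isk // tA eqxx andbT => hn.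
    by move: hD; rewrite /ndec /= ltn_neqAle eq_sym hn.
  rewrite kD !andbT; apply: sub_all hl' => d; exact: leq_trans.
have [g' hB' hm' hp hl] := merge_blocks hg hB tA tC h1 hm.
have hsz : size (S1 ++ merged X A C ++ S2) < size (S1 ++ [:: A, C & S2]).
  by rewrite /merged; case: ifP => _; rewrite !size_cat /=; lia.
have := IH _ cnt.+1 (leq_trans hsz hf) g' hB' (leq_trans hm' hm).
case=> r1 r2 r3 r4 [r5 r6 r7]; split=> //.
- exact: leq_trans r1 (ltnW hsz).
- exact: leq_trans r4 hm'.
- by split=> // [|i hi]; [rewrite r5 hp addnS | rewrite r7 // hl].
Qed.

Lemma init_types X n : n = size X ->
  all (good_block X) (init_blocks n) /\
  map (block_type X) (init_blocks n) = map (pair 0) X.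
Proof.
move=> ->; split.
  by apply/allP => A /mapP[a _ ->]; rewrite /good_block /constant_on /= eqxx.
rewrite /init_blocks -map_comp -[in RHS](mkseq_nth false X) /mkseq -map_comp.
by apply: eq_map => a.
Qed.

Lemma mass_init X : mass (map (pair 0) X) = size X.
Proof. by elim: X => [|x X IH]; rewrite ?mass_nil //= mass_cons IH. Qed.

Lemma pairwise_init X : pairwise ndec (map (pair 0) X).
Proof. by elim: X => //= x X ->; rewrite andbT; apply/allP => b /mapP[c _ ->]. Qed.

Lemma size_level_mass k B : size (level k B) * 2 ^ k <= mass B.
Proof.
elim: B => [|b B IH]; first by [].
rewrite mass_cons {1}/level /=; case: eqP => [e|_] /=; rewrite -/(level _ _).
  by rewrite mulSn e leq_add2l.
by apply: leq_trans IH _; rewrite leq_addl.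
Qed.

Lemma C_OP_pending K X : size X <= K -> C_OP X = pending K (map (pair 0) X).
Proof.
move=> hK; rewrite /C_OP /op_run; set n := size X; set F := fun st k => _.
have inv t : let r := foldl F (init_blocks n, 0) (iota 1 t) in
  let B := map (block_type X) r.1 in
  [/\ size r.1 <= n, all (good_block X) r.1, pairwise ndec B, mass B <= n
    & r.2 + pending K B = pending K (map (pair 0) X) /\
      forall i, i < t -> size (level i B) <= 1].
  elim: t => [|t [h1 h2 h3 h4 [h5 h6]]].
    have [g e] := @init_types X n erefl; rewrite /= e.
    by rewrite size_map size_iota mass_init; split=> //; exact: pairwise_init.
  have -> : iota 1 t.+1 = iota 1 t ++ [:: t.+1] by rewrite -[in LHS](addn1 t) iotaD.
  rewrite foldl_cat /=; move: h1 h2 h3 h4 h5 h6.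
  set r := foldl _ _ _ => h1 h2 h3 h4 h5 h6.
  have [r1 r2 r3 r4 [r5 r6 r7]] := op_phase_spec t r.2 h1 h2 h3 (leq_trans h4 hK).
  split=> //; [exact: leq_trans r1 h1|exact: leq_trans r4 h4|].
  split=> [|i]; first by rewrite r5.
  by rewrite ltnS leq_eqVlt => /orP[/eqP ->|hi] //; rewrite r7 // h6.
have [_ _ _ hm [<- hl]] := inv (trunc_log 2 n).
rewrite [pending _ _]pending0 ?addn0 // => k.
(* Levels below [trunc_log 2 n] were cleared by a phase; two blocks at a higher level would together
   exceed [n]. *)
case: (ltnP k (trunc_log 2 n)) => [/hl //|hk].
have h : n < 2 ^ k.+1 by apply: leq_trans (@trunc_log_ltn 2 n isT) _; rewrite leq_exp2l.
have := leq_ltn_trans (leq_trans (size_level_mass k _) hm) h.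
by rewrite expnS ltn_mul2r => /andP[_]; rewrite ltnS.
Qed.

(** * Normalising the absorbed segment *)

(** The number of binary digits of [n], zero for [n = 0]. It is the potential that pays for halvings
    of the gap. *)
Definition bit_length (n : nat) : nat := up_log 2 n.+1.

Lemma leq_bit_length m n : m <= n -> bit_length m <= bit_length n.
Proof. by move=> h; apply: leq_up_log. Qed.

Lemma bit_length_half m n : 0 < n -> 2 * m <= n -> bit_length m < bit_length n.
Proof.
move=> n0 h; have := @up_logP 2 n.+1 isT; rewrite -/(bit_length n).
case: (bit_length n) => [|k hk]; first by rewrite expn0 ltnS leqNgt n0.
rewrite ltnS; apply: up_log_min => //; move: hk; rewrite expnS; lia.
Qed.

Lemma exp_le_bit_length k n : 2 ^ k <= n.+1 -> k <= bit_length n.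
Proof. by move=> h; rewrite -(@leq_exp2l 2) //; apply: leq_trans h (up_logP _ _). Qed.

Lemma weight_dvd v k B : all (fun b => k <= b.1) B -> 2 ^ k %| weight v B.
Proof.
elim: B => [|b B IH] /=; first by rewrite weight_nil dvdn0.
move=> /andP[h1 h2]; rewrite weight_cons dvdn_add ?IH //.
by case: ifP => // _; apply: dvdn_exp2l.
Qed.

(* This identifies the [s_1] of greedy pairing with the level of the last
   absorbed block. *)
Lemma signed_sum_logn v n B a :
  pairwise dec (rcons B a) ->
  weight v (rcons B a) = n + weight (~~ v) (rcons B a) -> 0 < n /\ logn 2 n = a.1.
Proof.
rewrite pairwise_rcons -cats1 !weight_cat !weight_cons !weight_nil => /andP[h _].
have /dvdnP[p ->] := @weight_dvd v a.1.+1 B h.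
have /dvdnP[q ->] := @weight_dvd (~~ v) a.1.+1 B h.
rewrite expnS => e; set k := a.1 in e *.
have H P Q : 2 ^ k * P = n + 2 ^ k * Q -> odd P (+) odd Q ->
    exists m, n = 2 ^ k * m /\ odd m.
  move=> eP o; exists (P - Q); rewrite mulnBr eP addnK oddB //.
  by rewrite -(@leq_pmul2l (2 ^ k)) ?expn_gt0 // eP leq_addl.
(* The blocks before [a] contribute multiples of [2 ^ k.+1], so [a] makes the signed sum an odd
   multiple of [2 ^ k]. *)
have [m [-> om]] : exists m, n = 2 ^ k * m /\ odd m.
  by apply: (H (p.*2 + (a.2 == v)) (q.*2 + (a.2 == ~~ v)));
    case: (a.2) v e {H} => [] [] /=; rewrite ?oddD ?odd_double //=; lia.
have m0 : 0 < m by case: m om.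
split; first by rewrite muln_gt0 expn_gt0.
by rewrite lognM ?expn_gt0 // pfactorK // logn_coprime ?addn0 // coprime2n.
Qed.

(** Used with [m] the current gap and [v] the value of [S_1]: if an absorbed block of the other
    value later meets a block of its own size and of value [v], adding the latter to [S_1] halves
    the gap. *)
Definition bounded (v : bool) (m : nat) (B : seq (nat * bool)) : bool :=
  all (fun b => (b.2 == v) || (m <= 4 * 2 ^ b.1)) B.

Lemma against_cat v B C : against v (B ++ C) = against v B + against v C.
Proof. exact: count_cat. Qed.

(* [b] is carried into [Ab] as in a binary counter. Each merge lowers [pending]
   by one and [against] by at most one. *)
Lemma collapse K v Ab b Q Z :
  pairwise dec Ab -> pairwise ndec (rcons Ab b ++ Q ++ Z) ->
  mass (rcons Ab b ++ Q) <= K ->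
  exists Ab', [/\ pairwise dec Ab', pairwise ndec (Ab' ++ Q ++ Z),
     (forall u, weight u (rcons Ab b) + weight (~~ u) Ab' =
                weight (~~ u) (rcons Ab b) + weight u Ab'),
     mass Ab' <= mass (rcons Ab b)
   & pending K (Ab' ++ Q) + against v (rcons Ab b) <=
       pending K (rcons Ab b ++ Q) + against v Ab' /\
     forall m, bounded v m (rcons Ab b) -> bounded v m Ab'].
Proof.
elim/last_ind: Ab b => [|Ab [k x] IH] [l y] hd hn hm.
  by exists [:: (l, y)]; split=> // u; rewrite addnC.
move: hd; rewrite pairwise_rcons => /andP[hk hd].
have lk : l <= k.
  move: hn; rewrite -!cats1 -!catA pairwise_cat => /and3P[_ _].
  by rewrite /= => /andP[/andP[]].
have [ekl|nkl] := eqVneq l k; last first.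
  exists (rcons (rcons Ab (k, x)) (l, y)); split=> //; last by move=> u; rewrite addnC.
  have lt : l < k by rewrite ltn_neqAle nkl.
  rewrite !pairwise_rcons hk hd !andbT all_rcons [dec _ _]lt /=.
  by apply: sub_all hk => c /=; apply: ltn_trans.
have eR R : rcons (rcons Ab (k, x)) (l, y) ++ R = Ab ++ (k, x) :: (k, y) :: R.
  by rewrite ekl -!cats1 -!catA.
have eR0 := eR [::]; rewrite cats0 in eR0.
rewrite !eR in hn hm *; rewrite eR0.
have [hn1 hq] := pairwise_merge hn hk.
have kK : k < K by apply: leq_trans (level_lt_mass _ (k, x) _) hm.
have hQ : all (fun b => b.1 <= k) Q by move: hq; rewrite all_cat => /andP[].
have hp := @pending_merge K Ab k x y Q hk hQ kK.
have wm u := weight_merge u k x y.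
have mm := mass_merge k x y.
have am : against v [:: (k, x); (k, y)] <= (against v (merge_bits k x y)).+1.
  by rewrite /against /merge_bits; case: (x) (y) (v) => [] [] [].
have bm m : bounded v m [:: (k, x); (k, y)] -> bounded v m (merge_bits k x y).
  rewrite /bounded /merge_bits; case: eqP => //= _ /andP[/orP[->//|h] _].
  by rewrite expnS andbT; apply/orP; right; lia.
have e2 R : [:: (k, x), (k, y) & R] = [:: (k, x); (k, y)] ++ R by [].
move: hn1 hp wm mm am bm; rewrite /merge_bits; case: eqP => exy hn1 hp wm mm am bm.
  have eb R : Ab ++ [:: (k.+1, x)] ++ R = rcons Ab (k.+1, x) ++ R.
    by rewrite -cats1 -catA.
  have [] := IH (k.+1, x) hd; first by rewrite -eb.
    apply: leq_trans hm; rewrite -eb e2 !mass_cat; lia.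
  move=> Ab' [h1 h2 h3 h4 [h5 h6]]; rewrite -eb in h5.
  rewrite -cats1 in h3 h4 h5 h6.
  exists Ab'; split=> //.
  - by move=> u; have := h3 u; have := wm u; rewrite !weight_cat; lia.
  - by apply: leq_trans h4 _; rewrite !mass_cat; lia.
  split=> [|m]; first by move: h5; rewrite hp !against_cat; lia.
  by rewrite /bounded all_cat => /andP[b1 /bm b2]; apply: h6; rewrite /bounded all_cat b1.
(* Opposite values: both blocks vanish and the carry stops. *)
exists Ab; split=> //.
- by move=> u; have := wm u; rewrite !weight_cat !weight_nil; lia.
- by rewrite mass_cat leq_addr.
split=> [|m]; first by rewrite hp against_cat /=; move: am; rewrite {2}/against /=; lia.
by rewrite /bounded all_cat => /andP[].
Qed.

(** * Greedy pairing *)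

(* Truncated: [gap A T = 0] exactly when the greedy loop stops. *)
Definition gap (A : seq nat) (T : seq (nat * bool)) : nat := (mass T).+1 - size A.

(* [Ab]: ghost blocks absorbed into [S_1 = A]; [B]: ghost blocks made of bits of
   the prefix [Y]; [Z]: the single bits of [X] outside [Y]. *)
Record gp_state (X : seq bool) (K G0 : nat) (Z : seq (nat * bool))
    (A : seq nat) (S : seq (seq nat)) (cnt : nat) (Ab B : seq (nat * bool)) : Prop :=
  GPState {
    gp_good : all (good_block X) S;
    gp_const : constant_on X A;
    gp_neq0 : 0 < size A;
    gp_split : Ab ++ map (block_type X) S = B ++ Z;
    gp_dec : pairwise dec Ab;
    gp_ndec : pairwise ndec (B ++ Z);
    gp_weight : weight (bitX X (head 0 A)) Ab =
                size A + weight (~~ bitX X (head 0 A)) Ab;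
    gp_bounded : bounded (bitX X (head 0 A)) (gap A (map (block_type X) S)) Ab;
    gp_count : cnt + pending K B + bit_length (gap A (map (block_type X) S)) <=
               G0 + against (bitX X (head 0 A)) Ab + bit_length K;
    gp_major : Z = [::] \/ exists u, weight (~~ u) B + size Z < weight u B;
    gp_mass : mass (B ++ Z) <= K }.

Definition gp_inv X K G0 Z (S : seq (seq nat)) cnt : Prop :=
  if S is A :: S' then exists Ab B, gp_state X K G0 Z A S' cnt Ab B
  else cnt <= G0 + 2 * bit_length K.

(** In [gp_count], [against] is at most the number of absorbed blocks, which [size_dec] bounds. *)
Lemma gp_inv_bound X K G0 Z S cnt :
  gp_inv X K G0 Z S cnt -> cnt <= G0 + 2 * bit_length K.
Proof.
case: S => [//|A S] [Ab [B [_ _ _ hs hd _ _ _ hc _ hm]]].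
have hA : size Ab <= bit_length K.
  apply: exp_le_bit_length; apply: leq_trans (size_dec hd) _.
  by rewrite ltnS; apply: leq_trans hm; rewrite -hs mass_cat leq_addr.
have ha : against (bitX X (head 0 A)) Ab <= size Ab := count_size _ _.
by move: hc ha hA; case: bitX; lia.
Qed.

(* Re-establishes the invariant after [S_1] changed; [n] is its new size, and when
   [n = 0] the block vanishes and the next one takes its place. *)
Lemma settle X K G0 Z v n S S' cnt Ab B :
  let T := map (block_type X) S in
  all (good_block X) S -> Ab ++ T = B ++ Z -> pairwise dec Ab -> pairwise ndec (B ++ Z) ->
  weight v Ab = n + weight (~~ v) Ab -> bounded v ((mass T).+1 - n) Ab ->
  cnt + pending K B + bit_length ((mass T).+1 - n) <= G0 + against v Ab + bit_length K ->
  (Z = [::] \/ exists u, weight (~~ u) B + size Z < weight u B) -> mass (B ++ Z) <= K ->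
  (n = 0 /\ S' = S \/
   exists A, [/\ S' = A :: S, size A = n, 0 < n, constant_on X A & bitX X (head 0 A) = v]) ->
  gp_inv X K G0 Z S' cnt.
Proof.
move=> T hg hs hd hn hw hb hc hz hm [[n0 ->]|[A [-> eA n0 cA vA]]]; last first.
  by exists Ab, B; split; rewrite ?vA // /gap ?eA.
(* A nonempty strictly decreasing segment has a nonzero signed sum. *)
have Ab0 : Ab = [::].
  case/lastP: (Ab) hd hw => // Ab1 a hd hw.
  by have [] := signed_sum_logn hd hw; rewrite n0.
clear hb; move: hs hc hg; rewrite {}/T Ab0 n0 /against /=; case: S => [|C S] hs hc.
  by move=> _ /=; lia.
(* The next block becomes [S_1], with itself as the only absorbed block. *)
rewrite [all _ _]/= => /andP[gC gS]; exists [:: block_type X C], B.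
have sC := good_block_size gC erefl; have C0 := good_block_gt0 gC.
case/andP: (gC) => _ cC; split=> //=.
- rewrite !weight_cons !weight_nil -sC [(block_type X C).2]/(bitX X (head 0 C)) eqxx !addn0.
  by have -> : forall b, (b == ~~ b) = false; [case | rewrite addn0].
- by rewrite /bounded /= eqxx.
rewrite /against /= eqxx addn0; apply: leq_trans hc; rewrite leq_add2l.
by apply: leq_bit_length; rewrite /gap /= mass_cons; lia.
Qed.

Lemma combine_first X A C S :
  0 < size C -> size C <= size A -> constant_on X A -> constant_on X C ->
  let n := if bitX X (head 0 C) == bitX X (head 0 A) then size A + size C
           else size A - size C in
  n = 0 /\ combine_gp X [:: A, C & S] 0 = S \/
  exists A', [/\ combine_gp X [:: A, C & S] 0 = A' :: S, size A' = n, 0 < n,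
    constant_on X A' & bitX X (head 0 A') = bitX X (head 0 A)].
Proof.
move=> C0 hCA cA cC; rewrite /combine_gp /= drop0 query_eq eq_sym.
case: eqP => e /=.
  right; exists (A ++ C); rewrite size_cat addn_gt0 C0 orbT.
  split=> //; first by apply: constant_on_cat => //; lia.
  by case: (A) hCA => //=; case: (C) C0.
case: ltngtP hCA => // h _.
  have [cD bD] := constant_on_drop h cA.
  by right; exists (drop (size C) A); rewrite size_drop subn_gt0.
by left; rewrite h subnn.
Qed.

Lemma mass_level0 (W : seq (nat * bool)) : all (fun b : nat * bool => b.1 == 0) W -> mass W = size W.
Proof. by elim: W => [|b W IH] /=; rewrite ?mass_nil // mass_cons => /andP[/eqP -> /IH ->]. Qed.

(* If the ghost blocks up to some point contain all of [Y], then they outweigh the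
   rest of the list, so greedy pairing resets or stops. *)
Lemma gp_majority X K G0 Z A S cnt Ab B T1 T2 :
  all (fun b : nat * bool => b.1 == 0) Z ->
  gp_state X K G0 Z A S cnt Ab B -> map (block_type X) S = T1 ++ T2 -> T2 <> [::] ->
  size A + mass T1 <= mass T2 -> size (Ab ++ T1) < size B.
Proof.
move=> Z0 [_ _ _ hs _ _ hw _ _ hz _] eT T20 hm; rewrite ltnNge; apply/negP => hB.
rewrite eT catA in hs.
(* Otherwise [Ab ++ T1] contains all of [B], and [T2] consists of bits of [Z]. *)
have e1 : Ab ++ T1 = B ++ take (size (Ab ++ T1) - size B) Z.
  have := congr1 (take (size (Ab ++ T1))) hs.
  by rewrite take_size_cat // take_cat ltnNge hB.
set Z1 := take _ Z in e1.
have eZ : Z = Z1 ++ T2.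
  by move: hs; rewrite e1 -catA => /eqP; rewrite eqseq_cat // eqxx => /eqP ->.
have [Z1z T2z] : all (fun b : nat * bool => b.1 == 0) Z1 /\ all (fun b : nat * bool => b.1 == 0) T2.
  by move: Z0; rewrite eZ all_cat => /andP[].
case: hz => [zz|[u hu]]; first by rewrite zz in eZ; case: (Z1) eZ => //; case: (T2) T20.
(* The surplus of [u] in [B] exceeds [size Z], and [Z1] lowers it by at most [size Z1], so it stays
   above [size T2]. But the surplus in [Ab ++ T1] is at most [size A + mass T1]. *)
have := congr1 (weight u) e1; have := congr1 (weight (~~ u)) e1.
have := mass_weight u T1; have := mass_weight u Z1.
rewrite !weight_cat (mass_level0 Z1z); rewrite (mass_level0 T2z) in hm.
move: hu hw; rewrite eZ size_cat; case: (bitX X (head 0 A)); case: (u) => /=; lia.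
Qed.

Lemma leading_size X K G0 Z A S cnt Ab a B :
  gp_state X K G0 Z A S cnt (rcons Ab a) B ->
  logn 2 (size A) = a.1 /\ 2 ^ a.1 <= size A.
Proof.
case=> _ _ A0 _ hd _ hw _ _ _ _; have [_ e] := signed_sum_logn hd hw.
by split=> //; rewrite -e dvdn_leq // pfactor_dvdnn.
Qed.

Lemma bounded_le v m m' B : m' <= m -> bounded v m B -> bounded v m' B.
Proof.
move=> h; apply: sub_all => b /orP[->//|h']; apply/orP; right; exact: leq_trans h h'.
Qed.

(** The ghost makes no merge; [C] is appended to [Ab]. If [C] agrees with [S_1], the gap loses
    [2 * size C], at least half of it by the last hypothesis, and [bit_length] pays for the query.
    If not, [against] grows by one, and the same hypothesis makes [C] satisfy [bounded]. *)
Lemma reset_step X K G0 Z A C S cnt Ab B :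
  gp_state X K G0 Z A (C :: S) cnt Ab B -> size C <= size A ->
  size A <= sumsizes (C :: S) ->
  pairwise dec (rcons Ab (block_type X C)) ->
  gap A (map (block_type X) (C :: S)) <= 4 * 2 ^ (block_type X C).1 ->
  gp_inv X K G0 Z (combine_gp X [:: A, C & S] 0) cnt.+1.
Proof.
case=> hg cA A0 hs hd hn hw hb hc hz hm hCA hloop hd' hgap.
rewrite -(mass_blocks hg) in hloop.
move: hg; rewrite [all _ _]/= => /andP[gC gS].
have C0 := good_block_gt0 gC; have cC : constant_on X C by case/andP: gC.
have hcf := combine_first S C0 hCA cA cC.
have sC := good_block_size gC erefl.
have tC : block_type X C = ((block_type X C).1, bitX X (head 0 C)) by [].
move: hs hw hb hc hgap hloop hd'; rewrite /gap [map _ _]/= mass_cons.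
set T := map _ S; set t := block_type X C in sC tC *; set v := bitX X (head 0 A) in hcf *.
rewrite -/(t.1) -sC; move: hcf; rewrite (_ : bitX X (head 0 C) = t.2) //.
have st : 2 ^ t.1 = size C := esym sC.
move=> hcf hs hw hb hc hgap hloop hd'.
set n := if _ then _ else _ in hcf.
have wt u : weight u (rcons Ab t) = weight u Ab + (if t.2 == u then size C else 0).
  by rewrite -cats1 weight_cat weight_cons weight_nil addn0 sC.
have at_ : against v (rcons Ab t) = against v Ab + (t.2 != v).
  by rewrite -cats1 against_cat /against /= addn0.
have gn : (mass T).+1 - n <= (size C + mass T).+1 - size A - (if t.2 == v then 2 * size C else 0).
  by rewrite /n; case: ifP => _; clear -hCA; lia.
have bt : (t.2 == v) || ((mass T).+1 - n <= 4 * 2 ^ t.1).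
  by rewrite st; move: gn; case: (t.2 == v) => //=; rewrite subn0 => /leq_trans; apply.
have nE : n = if t.2 == v then size A + size C else size A - size C by [].
move: hcf; rewrite /= => hcf; clearbody n v t.
apply: (@settle _ _ _ _ v n S _ _ (rcons Ab t) B) => //.
- by rewrite cat_rcons.
- by rewrite !wt hw nE; clear -hCA; case: (t.2) (v) => [] [] /=; lia.
- rewrite /bounded all_rcons; apply/andP; split; first exact: bt.
  by apply: bounded_le hb; apply: leq_trans gn (leq_subr _ _).
- rewrite at_; case: eqP gn => /= _ gn; last first.
    by move: (leq_bit_length gn) hc; rewrite subn0 -/T; clear; lia.
  suff : bit_length ((mass T).+1 - n) < bit_length ((size C + mass T).+1 - size A).
    by move: hc; rewrite -/T; clear; lia.
  by apply: bit_length_half; clear -hloop gn hgap; lia.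
Qed.

Lemma cat_split (T : Type) (U V B Z : seq T) :
  U ++ V = B ++ Z -> size U <= size B -> exists2 Q, B = U ++ Q & V = Q ++ Z.
Proof.
elim: U B => [|u U IH] [|b B] //=; [by exists [::] | by exists (b :: B) |].
by case=> -> /IH h /h [Q -> ->]; exists Q.
Qed.

(** The ghost merges [C] with the last absorbed block [a], and the drop of [pending] pays for the
    query. *)
Lemma same_size_step X K G0 Z A C S cnt Ab a B :
  all (fun b : nat * bool => b.1 == 0) Z ->
  gp_state X K G0 Z A (C :: S) cnt (rcons Ab a) B ->
  size A <= sumsizes (C :: S) -> a.1 = (block_type X C).1 ->
  gp_inv X K G0 Z (combine_gp X [:: A, C & S] 0) cnt.+1.
Proof.
move=> Z0 st hloop ea; have [_ hA] := leading_size st.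
(* With [T1] empty, the loop condition is the hypothesis of [gp_majority], so [C] consists of bits
   of [Y]. *)
have ltB : size (rcons Ab a) < size B.
  rewrite -[rcons Ab a]cats0; apply: (gp_majority Z0 st (T2 := map (block_type X) (C :: S))) => //.
  by rewrite mass_nil addn0 mass_blocks //; case: st.
case: st => hg cA A0 hs hd hn hw hb hc hz hm.
rewrite -(mass_blocks hg) in hloop.
move: hg; rewrite [all _ _]/= => /andP[gC gS].
have C0 := good_block_gt0 gC; have cC : constant_on X C by case/andP: gC.
have sC : size C = 2 ^ (block_type X C).1 := good_block_size gC erefl.
have hCA : size C <= size A by rewrite sC -ea.
rewrite -ea in sC.
have hcf := combine_first S C0 hCA cA cC.
move: hs hw hb hc hloop; rewrite /gap [map _ _]/= mass_cons.
set T := map _ S; set v := bitX X (head 0 A) in hcf *.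
have -> : block_type X C = (a.1, bitX X (head 0 C)) by rewrite ea.
rewrite [(_, _).1]/= -sC.
set y := bitX X (head 0 C) in hcf *; case: a {ea} sC hd ltB hA => k x /= sC hd ltB hA.
move=> hs hw hb hc hloop.
have [Q eB eT] : exists2 Q, B = Ab ++ (k, x) :: (k, y) :: Q & T = Q ++ Z.
  move: hs; rewrite -cat_rcons => /cat_split[|Q eB eT]; first by rewrite size_rcons.
  by exists Q; rewrite // eB !cat_rcons.
move: hd; rewrite pairwise_rcons => /andP[hk hd].
rewrite eB -!catA !cat_cons in hn hm.
rewrite eB in hc hz.
have [hn1 hq] := pairwise_merge hn hk.
have hQ : all (fun b => b.1 <= k) Q by move: hq; rewrite all_cat => /andP[].
have e2 R : [:: (k, x), (k, y) & R] = [:: (k, x); (k, y)] ++ R by [].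
have kK : k < K by apply: leq_trans (level_lt_mass _ (k, x) _) hm.
have hp := @pending_merge K Ab k x y Q hk hQ kK.
set n := if _ then _ else _ in hcf.
have ax : against v (rcons Ab (k, x)) = against v Ab + (x != v).
  by rewrite -cats1 against_cat /against /= addn0.
have gn : (mass T).+1 - n <= (size C + mass T).+1 - size A - (if y == v then 2 * size C else 0).
  by rewrite /n; case: ifP => _; clear -hCA; lia.
have gn' := leq_trans gn (leq_subr _ _).
have nE : n = if y == v then size A + size C else size A - size C by [].
move: hcf; rewrite /= => hcf; clearbody n v y.
have wn Ab' : (forall u, weight u (Ab ++ [:: (k, x); (k, y)]) + weight (~~ u) Ab' =
    weight (~~ u) (Ab ++ [:: (k, x); (k, y)]) + weight u Ab') ->
    weight v Ab' = n + weight (~~ v) Ab'.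
  move=> /(_ v); move: hw; rewrite -cats1 !weight_cat !weight_cons !weight_nil /= -sC nE.
  by clear -hCA; case: y v => [] [] /=; lia.
have zz Ab' : (forall u, weight u (Ab ++ [:: (k, x); (k, y)]) + weight (~~ u) Ab' =
    weight (~~ u) (Ab ++ [:: (k, x); (k, y)]) + weight u Ab') ->
    Z = [::] \/ exists u, weight (~~ u) (Ab' ++ Q) + size Z < weight u (Ab' ++ Q).
  move=> h; case: hz => [|[u hu]]; first by left.
  right; exists u; move: hu (h u); rewrite e2 !weight_cat; clear; lia.
have wm u := weight_merge u k x y.
have bR : bounded v ((mass T).+1 - n) (rcons Ab (k, x)) by apply: bounded_le gn' hb.
move: bR; rewrite /bounded all_rcons => /andP[bx bA].
move: wm hn1 hp; rewrite /merge_bits; case: eqP => exy wm hn1 hp; last first.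
  have wA u : weight u (Ab ++ [:: (k, x); (k, y)]) + weight (~~ u) Ab =
    weight (~~ u) (Ab ++ [:: (k, x); (k, y)]) + weight u Ab.
    by move: (wm u); rewrite !weight_cat !weight_nil; clear; lia.
  apply: (@settle _ _ _ _ v n S _ _ Ab (Ab ++ Q)) => //.
  - by rewrite -/T eT catA.
  - by rewrite -catA.
  - exact: wn.
  - move: hc; rewrite hp ax /= -/T.
    case: (eqVneq y v) gn => [eyv|nyv] gn.
      (* Here [a] also leaves [against], and the merge is already spent on the query. By [bounded]
         the gap is at most [4 * size C], so [C] halves it and [bit_length] makes up for the
         loss. *)
      have xv : x != v by apply/eqP => exv; apply: exy; rewrite exv eyv.
      have hgp : (size C + mass T).+1 - size A <= 4 * size C.
        by move: hb; rewrite /bounded all_rcons /= (negbTE xv) sC /= => /andP[].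
      suff : bit_length ((mass T).+1 - n) < bit_length ((size C + mass T).+1 - size A).
        by rewrite xv; clear; lia.
      by apply: bit_length_half; clear -hloop gn hgp; lia.
    suff -> : x == v by move: (leq_bit_length gn'); rewrite addn0; clear; lia.
    by apply/eqP; case: (x) (y) (v) exy nyv => [] [] [].
  - exact: zz.
  - by apply: leq_trans hm; rewrite -catA !(mass_cat, mass_cons); clear; lia.
(* Equal values: the merged block may carry further into [Ab]; in [collapse] every block lost from
   [against] is matched by an extra merge. *)
have cE R : Ab ++ [:: (k.+1, x)] ++ R = rcons Ab (k.+1, x) ++ R by rewrite -cats1 -catA.
rewrite cE in hn1; rewrite cE in hp.
have hmQ : mass (rcons Ab (k.+1, x) ++ Q) <= K.
  by apply: leq_trans hm; rewrite -cE e2 !mass_cat !mass_cons !mass_nil /= expnS; clear; lia.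
have [Ab' [h1 h2 h3 h4 [h5 h6]]] := collapse v hd hn1 hmQ.
have wA u : weight u (Ab ++ [:: (k, x); (k, y)]) + weight (~~ u) Ab' =
    weight (~~ u) (Ab ++ [:: (k, x); (k, y)]) + weight u Ab'.
  by move: (h3 u) (wm u); rewrite -cats1 !weight_cat; clear; lia.
apply: (@settle _ _ _ _ v n S _ _ Ab' (Ab' ++ Q)) => //.
- by rewrite -/T eT catA.
- by rewrite -catA.
- exact: wn.
- apply: h6; rewrite /bounded all_rcons bA andbT -/T.
  by case/orP: bx => [->//|h]; apply/orP; right; rewrite /= expnS; move: h => /=; clear; lia.
- rewrite -/T; move: h5 hc (leq_bit_length gn'); rewrite hp ax -cats1 against_cat.
  by rewrite {2}/against /=; clear; lia.
- exact: zz.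
- apply: leq_trans hm; move: h4; rewrite -cats1 -catA e2 !(mass_cat, mass_cons, mass_nil).
  by rewrite /= expnS; clear; lia.
Qed.

Lemma map_eq_cat (T U : Type) (f : T -> U) S P Q : map f S = P ++ Q ->
  exists S1 S2, [/\ S = S1 ++ S2, map f S1 = P & map f S2 = Q].
Proof.
move=> h; exists (take (size P) S), (drop (size P) S).
by rewrite cat_take_drop map_take map_drop h take_size_cat // drop_size_cat.
Qed.

(** [S_1] and [Ab] are untouched, the gap does not grow, and the ghost does the same merge inside
    [B], so [pending] pays. *)
Lemma inner_step X K G0 Z A S1 C D S2 cnt Ab B k x y :
  gp_state X K G0 Z A (S1 ++ C :: D :: S2) cnt Ab B ->
  block_type X C = (k, x) -> block_type X D = (k, y) ->
  all (fun b => k < b.1) (Ab ++ map (block_type X) S1) ->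
  (size (Ab ++ map (block_type X) S1)).+1 < size B ->
  gp_inv X K G0 Z (A :: S1 ++ merged X C D ++ S2) cnt.+1.
Proof.
case=> hg cA A0 hs hd hn hw hb hc hz hm tC tD hk hlt.
move: hs hb hc hg; rewrite !map_cat [map _ [:: _, _ & _]]/= tC tD.
rewrite !all_cat [all _ [:: _, _ & _]]/= => hs hb hc /and4P[g1 gC gD g2].
have [gM tM] := merged_blocks gC gD tC tD.
set P := map _ S1 in hs hb hc hk hlt *; set T := map _ S2 in hs hb hc.
have [Q eB eT] : exists2 Q, B = (Ab ++ P) ++ (k, x) :: (k, y) :: Q & T = Q ++ Z.
  have e R : (Ab ++ P) ++ (k, x) :: (k, y) :: R = (Ab ++ P ++ [:: (k, x); (k, y)]) ++ R.
    by rewrite -!catA.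
  move: hs; rewrite catA e => /cat_split[|Q eB eT].
    by move: hlt; rewrite catA !size_cat /=; clear; lia.
  by exists Q; rewrite // eB e.
rewrite eB -!catA !cat_cons catA in hn hm; rewrite eB in hz hc.
have [hn' hq] := pairwise_merge hn hk.
have hQ : all (fun b => b.1 <= k) Q by move: hq; rewrite all_cat => /andP[].
have kK : k < K by apply: leq_trans (level_lt_mass _ (k, x) _) hm.
have hp := @pending_merge K (Ab ++ P) k x y Q hk hQ kK.
have mm := mass_merge k x y.
have e2 R : [:: (k, x), (k, y) & R] = [:: (k, x); (k, y)] ++ R by [].
exists Ab, ((Ab ++ P) ++ merge_bits k x y ++ Q).
have gle : gap A (map (block_type X) (S1 ++ merged X C D ++ S2)) <=
    gap A (P ++ [:: (k, x), (k, y) & T]).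
  rewrite /gap leq_sub2r // ltnS !map_cat tM e2 !mass_cat.
  by rewrite leq_add2l leq_add2r.
split=> //.
- by rewrite !all_cat g1 gM g2.
- by rewrite !map_cat tM -/P -/T eT -!catA.
- by rewrite -!catA; rewrite -catA in hn'.
- exact: bounded_le gle hb.
- by move: hc (leq_bit_length gle); rewrite hp; clear; lia.
- case: hz => [|[u hu]]; [by left | right; exists u].
  by move: hu (weight_merge u k x y); rewrite e2 !weight_cat; clear; lia.
- apply: leq_trans hm; rewrite -!catA e2 !mass_cat; move: mm; clear; lia.
Qed.

Lemma gp_step X K G0 Z A S cnt Ab B :
  all (fun b : nat * bool => b.1 == 0) Z ->
  gp_state X K G0 Z A S cnt Ab B -> size A <= sumsizes S ->
  gp_inv X K G0 Z (combine_gp X (A :: S) (gp_index (A :: S))) cnt.+1.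
Proof.
move=> Z0 st hloop; case/lastP: Ab st => [|Ab a] st.
  (* An empty [Ab] has signed sum zero, but [S_1] is nonempty. *)
  by case: st => _ _ + _ _ _; rewrite !weight_nil addn0 => h e; rewrite -e in h.
have [hl hA] := leading_size st.
have hg := gp_good st; have hd := gp_dec st.
have hn : pairwise ndec (a :: map (block_type X) S).
  have := gp_ndec st; rewrite -(gp_split st) -cats1 -catA pairwise_cat.
  by case/and3P.
(* The search for the greedy index thus runs over ghost levels, starting at the last absorbed
   block. *)
have svE : svals (A :: S) = map fst (a :: map (block_type X) S).
  by rewrite /= hl -map_comp.
have reset t T : map (block_type X) S = t :: T -> t.1 < a.1 ->
    gap A (map (block_type X) S) <= 4 * 2 ^ t.1 ->
    gp_inv X K G0 Z (combine_gp X (A :: S) 0) cnt.+1.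
  clear hn svE; case: S st hloop hg => [//|C S] st hloop hg [tC _] hta hgap.
  rewrite -tC in hta hgap; move: hg => /= /andP[gC _].
  apply: (reset_step st) => //.
    by apply: leq_trans hA; rewrite (good_block_size gC erefl) leq_exp2l // ltnW.
  rewrite pairwise_rcons hd andbT all_rcons; apply/andP; split=> //.
  move: hd; rewrite pairwise_rcons => /andP[h _]; apply: sub_all h => b /=.
  exact: ltn_trans.
rewrite /gp_index svE first_pair_map.
have [[-> hs]|[S1 [b [c [S2 [eL -> hbc hs]]]]]] :=
  first_pair_split (fun u v : nat * bool => u.1 == v.1) (a :: map (block_type X) S).
  (* No equal neighbours: [first_pair] returns the length, nothing is left to drop, and [gp_index]
     falls back to [0]. All levels strictly decrease, which bounds the gap. *)
  have -> : size (a :: map (block_type X) S) = size (A :: S) by rewrite /= size_map.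
  rewrite take_oversize // drop_oversize //.
  have -> : sumsizes [::] < sumsizes (A :: S).
    by rewrite /sumsizes /= ltn_addr // (gp_neq0 st).
  case eT : (map (block_type X) S) => [|t T].
    by move: hloop; rewrite -(mass_blocks hg) eT mass_nil leqNgt (gp_neq0 st).
  rewrite eT in hn hs; have hdec := pairwise_ndec_neq hn hs.
  apply: (reset t T eT); first by move: hdec => /= /andP[/andP[]].
  rewrite eT /gap; have hdt : pairwise dec (t :: T) by case/andP: hdec.
  by have := mass_dec hdt; have := gp_neq0 st; clear; lia.
case: S1 eL hs => [|a' P] [ea eT] hs.
  (* The pair found is [S_1], [S_2], so the index is [0] with or without the reset. *)
  rewrite if_same; case: S st hloop eT {hg hn svE reset} => [//|C S] st hloop [tC _].
  apply: (same_size_step Z0 st hloop); rewrite tC ea; exact/eqP.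
have hT : mass (map (block_type X) S) = mass (rcons P b) + mass (c :: S2).
  by rewrite eT -cats1 -mass_cat -catA.
rewrite eT in hn; rewrite -ea in hs.
have hdec : pairwise dec (a :: rcons P b).
  apply: pairwise_ndec_neq; last by rewrite rcons_cons in hs.
  by move: hn; rewrite -cat_rcons -cat_cons pairwise_cat => /and3P[].
have hk : all (fun d => b.1 < d.1) (rcons Ab a ++ P).
  have hP := hdec; rewrite -rcons_cons pairwise_rcons in hP.
  case/andP: hP => /= /andP[hba hbP] _; rewrite all_cat hbP andbT all_rcons.
  apply/andP; split=> //; move: hd; rewrite pairwise_rcons => /andP[h _].
  by apply: sub_all h => d /=; apply: ltn_trans.
have [SP [[|C [|D SQ]] [eS eP]]] := map_eq_cat eT; case=> // tC tD eQ.
have es : [/\ sumsizes (take (size (a' :: P)).+1 (A :: S)) = size A + mass (rcons P b)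
    & sumsizes (drop (size (a' :: P)).+1 (A :: S)) = mass (c :: S2)].
  have hg' := hg; rewrite eS -cat_rcons all_cat in hg'; case/andP: hg' => g1 g2.
  have -> : (size (a' :: P)).+1 = (size (rcons SP C)).+1.
    by rewrite /= -eP size_map size_rcons.
  rewrite eS -cat_rcons /= take_size_cat // drop_size_cat //; split.
    by rewrite /sumsizes /= -/(sumsizes _) -(mass_blocks g1) map_rcons eP tC.
  by rewrite -(mass_blocks g2) /= tD eQ.
have [-> ->] := es.
case: ltnP => hres.
  (* A reset: the tail from [c] on weighs less than [S_1] and [rcons P b] together, so the gap is at
     most twice the mass of [rcons P b], itself below [2 * 2 ^ t.1]. Hence the factor 4. *)
  case eP' : (rcons P b) => [|t T]; first by case: (P) eP'.
  rewrite eP' in hdec hres hT.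
  apply: (reset t (T ++ c :: S2)).
  - by rewrite eT -cat_rcons eP'.
  - by case/andP: hdec => /= /andP[].
  have hdt : pairwise dec (t :: T) by case/andP: hdec.
  by rewrite /gap hT; move: (mass_dec hdt) hres; clear; lia.
have tC' : block_type X C = (b.1, b.2) by rewrite tC; case: (b).
have tD' : block_type X D = (b.1, c.2) by rewrite tD (eqP hbc); case: (c).
have eb : (size (a' :: P)) = size (A :: SP) by rewrite /= -eP size_map.
rewrite eb eS -cat_cons combine_gpE; last first.
  have hg' := hg; rewrite eS all_cat /= in hg'; case/and4P: hg' => _ gC gD _.
  by rewrite (good_block_size gC tC') (good_block_size gD tD').
rewrite eS in st.
rewrite cat_cons; apply: (inner_step st tC' tD'); rewrite eP //.
(* No reset: [hres] is the hypothesis of [gp_majority], so [c] lies in [B] too. *)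
have hlt : size (rcons Ab a ++ rcons P b) < size B.
  by apply: (gp_majority Z0 st _ _ hres); rewrite // -eS eT cat_rcons.
by move: hlt; rewrite !size_cat (size_rcons P) addnS.
Qed.

Lemma gp_loop_bound X K G0 Z f S cnt :
  all (fun b : nat * bool => b.1 == 0) Z ->
  gp_inv X K G0 Z S cnt -> gp_loop f X S cnt <= G0 + 2 * bit_length K.
Proof.
move=> Z0; elim: f S cnt => [|f IH] S cnt hS; first exact: gp_inv_bound hS.
rewrite [gp_loop _ _ _ _]/=; case: ifP => [/andP[]|_]; last exact: gp_inv_bound hS.
case: S hS => [//|A S] [Ab [B st]] _ hl; apply: IH.
exact: gp_step Z0 st hl.
Qed.

(** * The majority prefix and the initial state *)

Lemma weight_init v X : weight v (map (pair 0) X) = count (pred1 v) X.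
Proof. by elim: X => [|x X IH]; rewrite ?weight_nil //= weight_cons IH /=; case: eqP. Qed.

Lemma count_take_attained (T : Type) (p : pred T) s c :
  c <= count p s -> exists2 m, m <= size s & count p (take m s) = c.
Proof.
elim: s c => [|x s IH] c /=; first by rewrite leqn0 => /eqP ->; exists 0.
case: c => [_|c]; first by exists 0.
case hx: (p x) => /=.
  by rewrite add1n ltnS => /IH[m hm e]; exists m.+1; rewrite //= hx e.
by rewrite add0n => /IH[m hm e]; exists m.+1; rewrite //= hx e.
Qed.

Lemma prefM_majority X :
  prefM X <= size X /\
  (drop (prefM X) X = [::] \/
   exists u, count (pred1 u) (take (prefM X) X) = (size X)./2.+1).
Proof.
rewrite /prefM; case: eqP => [_|hne].
  by rewrite leqnn drop_size; split=> //; left.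
set v := _ < _; set p := fun m => _.
have hv : (size X)./2.+1 <= count (pred1 v) X.
  have e1 : count (pred1 true) X = count id X by apply: eq_count => -[].
  have e0 : count (pred1 false) X = count negb X by apply: eq_count => -[].
  have e2 : count id X + count negb X = size X by rewrite -(count_predC id X).
  have := odd_double_half (size X); move: hne e2.
  by rewrite /v; case: (ltnP (count negb X) (count id X)); rewrite ?e1 ?e0; clear; lia.
have [m hm hc] := count_take_attained hv.
(* So [find] succeeds instead of returning its default. *)
have hp : has p (iota 0 (size X).+1).
  by apply/hasP; exists m; [rewrite mem_iota ltnS | apply/eqP].
have hf := hp; rewrite has_find size_iota ltnS in hf.
split=> //; right; exists v.
by have := nth_find 0 hp; rewrite nth_iota ?ltnS // add0n => /eqP.
Qed.

Lemma C_GP_bound X : 0 < size X ->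
  C_GP X <= C_OP (take (prefM X) X) + 2 * bit_length (size X).
Proof.
move=> hX; have [hM hmaj] := prefM_majority X.
set M := prefM X in hM hmaj *; set K := size X.
have sY : size (take M X) = M by rewrite size_take_min; apply/minn_idPl.
rewrite (@C_OP_pending K) ?sY //.
have Z0 : all (fun b : nat * bool => b.1 == 0) (map (pair 0) (drop M X)).
  by apply/allP => b /mapP[c _ ->].
rewrite /C_GP; apply: (@gp_loop_bound X K (pending K (map (pair 0) (take M X))) _ _ _ 0 Z0).
have [hg ht] := @init_types X (size X) erefl.
have hBZ : map (pair 0) (take M X) ++ map (pair 0) (drop M X) = map (pair 0) X.
  by rewrite -map_cat cat_take_drop.
have hmass := mass_init X.
have hnd := pairwise_init X.
rewrite -/K in hg ht hmass *; rewrite /K in hX.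
move: hg ht hBZ hmass hnd; case eS : (init_blocks K) => [|A S].
  by move: (congr1 size eS); rewrite size_map size_iota /K; case: (size X) hX.
have eA : A = [:: 0] by move: eS; rewrite /init_blocks /K; case: (size X) hX => // n _ [].
move=> /andP[_ hg] ht hBZ hmass hnd.
(* At the start only the first bit is absorbed, and the ghost list is [X] itself, cut after [Y]. *)
exists [:: (0, bitX X 0)], (map (pair 0) (take M X)); rewrite eA.
split=> //; rewrite ?hBZ //.
- by rewrite /constant_on /= eqxx.
- by rewrite -ht eA.
- have nv b : (b == ~~ b) = false by case: b.
  by rewrite !weight_cons !weight_nil eqxx [_.2]/= nv.
- by rewrite /bounded /= eqxx.
- rewrite add0n /against /= eqxx !addn0 leq_add2l; apply: leq_bit_length.
  by rewrite -hmass -ht eA /gap [map _ (_ :: _)]/= mass_cons subn1 leq_addl.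
- case: hmaj => [->|[u hu]]; [by left | right; exists u].
  rewrite !weight_init hu size_map size_drop -/K.
  (* The other bits of [Y] and the bits outside [Y] number [K - K./2.+1] in all, fewer than
     [K./2.+1]. *)
  have := count_predC (pred1 u) (take M X); rewrite hu sY.
  rewrite (@eq_count _ (predC (pred1 u)) (pred1 (~~ u))); last by case: (u) => -[].
  by have := odd_double_half K; rewrite -/K; move: hM; rewrite -/K; lia.
by rewrite hmass.
Qed.

(* Real logarithms and the constant *)
From Stdlib Require Import Reals Lra.

Lemma bit_length_ln n : 1 < n ->
  (INR (bit_length n) <= 2 * (ln (INR n) / ln 2) ^ 2)%R.
Proof.
move=> n1; have l2 : (0 < ln 2)%R by have := ln_lt_2; lra.
have pl k : expn 2 k <= n -> (INR k <= ln (INR n) / ln 2)%R.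
  move=> hk; apply: (Rmult_le_reg_r (ln 2)) => //.
  have -> : (ln (INR n) / ln 2 * ln 2 = ln (INR n))%R by field; lra.
  rewrite -ln_pow; last lra.
  have e : INR (expn 2 k) = (2 ^ k)%R by elim: (k) => // j IH; rewrite expnS mult_INR IH.
  have := le_INR _ _ (leP hk); rewrite e => -[lt | ->]; last exact: Rle_refl.
  by left; apply: ln_increasing lt; apply: pow_lt; lra.
(* The logarithm [L] is at least 1, so [k <= L] gives [k + 1 <= 2 * L <= 2 * L ^ 2]. *)
have h1 := pl 1 n1.
have [k ek] : exists k, bit_length n = k.+1.
  by exists (bit_length n).-1; rewrite prednK // (leq_ltn_trans _ (@bit_length_half 0 n _ _)) //; lia.
have /andP[] := @up_log_bounds 2 n.+1 isT (leqW n1); rewrite -/(bit_length n) ek ltnS => hk _.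
have h2 := pl k hk; rewrite S_INR; move: h1; rewrite /= => h1.
set L := (_ / _)%R in h1 h2 *; nra.
Qed.

Theorem mainTheorem6 :
  exists d : R, forall X : seq bool, (1 <= size X)%N ->
    (INR (C_GP X) <= INR (C_OP (take (prefM X) X))
                     + d * (ln (INR (size X)) / ln 2) ^ 2)%R.
Proof.
(* Two [bit_length] terms, each at most twice the squared logarithm. *)
exists 4%R => X hX; have [n1|n1] := ltnP 1 (size X).
  have := bit_length_ln n1; have := le_INR _ _ (leP (C_GP_bound hX)).
  by rewrite plus_INR mult_INR /=; lra.
(* For a single bit the logarithm is 0 but [bit_length] is 1, so [C_GP] is computed directly. *)
case: X hX n1 => [//|x [|//]] _ _.
set L := (_ / _)%R; have := pos_INR (C_OP (take (prefM [:: x]) [:: x])).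
have -> : C_GP [:: x] = 0 by [].
by move=> h; rewrite /=; nra.
Qed.
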